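(* Let $b^*$ be a minimizer of $P$ and let $\mathcal{A}^*=\{i : b^*_{I_i}\neq 0\}$ be its set of active (relevant) groups. Let $(b^k,\theta^k)_{k\ge 1}$ be the primal-dual iterates of an arbitrary iterative method, with $b^k\in\mathbb{R}^d$ and $\theta^k\in\Delta$ for every $k$, and let $\mathcal{A}_0=\{1,\ldots,m\}\supseteq \mathcal{A}_1\supseteq\mathcal{A}_2\supseteq\cdots$ be the active group sets produced by the screening rule along these iterates. Then the screening rule never discards a relevant group: $\mathcal{A}^*\subseteq\mathcal{A}_k$ for every $k\ge 0$. Equivalently, every group $i$ discarded by the rule at any iteration satisfies $b^*_{I_i}=0$.
   Context: Group SLOPE. Let $X\in\mathbb{R}^{n\times d}$, $y\in\mathbb{R}^n$, let $I=\{I_1,\ldots,I_m\}$ be a partition of $\{1,\ldots,d\}$, let $w_1,\ldots,w_m>0$ be weights and let $\lambda_1\ge\cdots\ge\lambda_m\ge 0$. For $v\in\mathbb{R}^m$ let $J_\lambda(v)=\sum_{i=1}^m\lambda_i|v|_{[i]}$, where $|v|_{[1]}\ge\cdots\ge|v|_{[m]}$ are the sorted absolute values. Group SLOPE is the problem $$\min_{\beta\in\mathbb{R}^d}\tfrac12\|y-X\beta\|_2^2+J_\lambda\big(w_1\|X_{I_1}\beta_{I_1}\|_2,\ldots,w_m\|X_{I_m}\beta_{I_m}\|_2\big).$$ Decoupled form. Write $X_{I_i}=U_iR_i$ where $U_i\in\mathbb{R}^{n\times|I_i|}$ has orthonormal columns and $R_i$ has full row rank, and let $\hat X\in\mathbb{R}^{n\times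 d}$ be the matrix with blocks $\hat X_{I_i}=U_i/w_i$. With $b_{I_i}=w_iR_i\beta_{I_i}$, Group SLOPE becomes the minimization over $b\in\mathbb{R}^d$ of $$P(b)=\tfrac12\|y-\hat Xb\|_2^2+J_\lambda\big(\|b_{I_1}\|_2,\ldots,\|b_{I_m}\|_2\big).$$ Dual. The dual problem is $\max_{\theta\in\Delta}D(\theta)$, where $D(\theta)=-\sum_{i=1}^n\big(\tfrac12\theta_i^2+\theta_iy_i\big)$ and $\Delta$ (the dual feasible set) is the set of $\theta\in\mathbb{R}^n$ such that, with $\widetilde\theta=(\|\hat X_{I_1}^\top\theta\|_2,\ldots,\|\hat X_{I_m}^\top\theta\|_2)$ and $\widetilde\theta_{[1]}\ge\cdots\ge\widetilde\theta_{[m]}$ its sorted entries, $\sum_{j\le i}\widetilde\theta_{[j]}\le\sum_{j\le i}\lambda_j$ for all $i=1,\ldots,m$. The duality gap is $G(b,\theta)=P(b)-D(\theta)$. Screening rule. At iteration $k$, start from $\mathcal{A}=\mathcal{A}_{k-1}$ (with $\mathcal{A}_0=\{1,\ldots,m\}$) and repeat the following step until $\mathcal{A}$ no longer changes (or is empty): discard from $\mathcal{A}$ every group $i\in\mathcal{A}$ for which $$\|\hat X_{I_i}^\top\theta^k\|_2+\|\hat X_{I_i}\|_2\sqrt{2G(b^k,\theta^k)}<\lambda_{|\mathcal{A}|},$$ where $\|\hat X_{I_i}\|_2$ is the spectral norm and $|\mathcal{A}|$ is the cardinality of $\mathcal{A}$ at the beginning of the step. The final set is $\mathcal{A}_k$.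 *)

(* Defs.v *)
From mathcomp Require Import boolp classical_sets reals.
From mathcomp Require Import all_boot all_order all_algebra.
Set Implicit Arguments.
Unset Strict Implicit.
Unset Printing Implicit Defensive.
Import Order.TTheory GRing.Theory Num.Theory.
Local Open Scope ring_scope.

(* Groups are indexed by ['I_m]: [I i] is the set of coordinates of group [i].
   All indices are 0-based, so the (k+1)-st largest entry and lambda_(k+1) sit
   at position [k]. *)

Definition norm2 (R : realType) (n : nat) (x : 'cV[R]_n) : R :=
  Num.sqrt (\sum_i x i 0 ^+ 2).

Definition spectral_norm (R : realType) (n p : nat) (A : 'M[R]_(n, p)) : R :=
  sup [set norm2 (A *m x) | x in [set x : 'cV[R]_p | norm2 x <= 1]]%classic.

(* The columns of [A] (rows of [b]) with index in [S], in increasing order. *)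
Definition col_block (R : realType) (n d : nat) (A : 'M[R]_(n, d))
    (S : {set 'I_d}) : 'M[R]_(n, #|S|) :=
  colsub (fun j : 'I_#|S| => enum_val j) A.

Definition row_block (R : realType) (d : nat) (b : 'cV[R]_d) (S : {set 'I_d}) :
    'cV[R]_#|S| :=
  rowsub (fun j : 'I_#|S| => enum_val j) b.

(* The entries of [v] in nonincreasing order. *)
Definition sorted_entries (R : realType) (m : nat) (v : 'cV[R]_m) : seq R :=
  sort >=%R [seq v i 0 | i <- enum 'I_m].

Definition slope_norm (R : realType) (m : nat) (lam : m.-tuple R)
    (v : 'cV[R]_m) : R :=
  \sum_(i < m) lam`_i * (sorted_entries (map_mx Num.norm v))`_i.

Definition primal (R : realType) (n d m : nat) (y : 'cV[R]_n)
    (Xhat : 'M[R]_(n, d)) (I : 'I_m -> {set 'I_d}) (lam : m.-tuple R)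
    (b : 'cV[R]_d) : R :=
  2^-1 * norm2 (y - Xhat *m b) ^+ 2
  + slope_norm lam (\col_i norm2 (row_block b (I i))).

Definition dual (R : realType) (n : nat) (y theta : 'cV[R]_n) : R :=
  - \sum_i (2^-1 * theta i 0 ^+ 2 + theta i 0 * y i 0).

Definition group_corr (R : realType) (n d m : nat) (Xhat : 'M[R]_(n, d))
    (I : 'I_m -> {set 'I_d}) (theta : 'cV[R]_n) : 'cV[R]_m :=
  \col_i norm2 ((col_block Xhat (I i))^T *m theta).

Definition dual_feasible (R : realType) (n d m : nat) (Xhat : 'M[R]_(n, d))
    (I : 'I_m -> {set 'I_d}) (lam : m.-tuple R) (theta : 'cV[R]_n) : Prop :=
  forall i : 'I_m,
    \sum_(j < m | (j <= i)%N) (sorted_entries (group_corr Xhat I theta))`_j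
    <= \sum_(j < m | (j <= i)%N) lam`_j.

Definition gap (R : realType) (n d m : nat) (y : 'cV[R]_n)
    (Xhat : 'M[R]_(n, d)) (I : 'I_m -> {set 'I_d}) (lam : m.-tuple R)
    (b : 'cV[R]_d) (theta : 'cV[R]_n) : R :=
  primal y Xhat I lam b - dual y theta.

(* lambda_|A| is [lam`_(#|A|.-1)]; if [A] is empty nothing is tested. *)
Definition discarded (R : realType) (n d m : nat) (y : 'cV[R]_n)
    (Xhat : 'M[R]_(n, d)) (I : 'I_m -> {set 'I_d}) (lam : m.-tuple R)
    (b : 'cV[R]_d) (theta : 'cV[R]_n) (A : {set 'I_m}) (i : 'I_m) : bool :=
  norm2 ((col_block Xhat (I i))^T *m theta)
  + spectral_norm (col_block Xhat (I i))
    * Num.sqrt (2 * gap y Xhat I lam b theta)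
  < lam`_(#|A|.-1).

Definition screen_step (R : realType) (n d m : nat) (y : 'cV[R]_n)
    (Xhat : 'M[R]_(n, d)) (I : 'I_m -> {set 'I_d}) (lam : m.-tuple R)
    (b : 'cV[R]_d) (theta : 'cV[R]_n) (A : {set 'I_m}) : {set 'I_m} :=
  [set i in A | ~~ discarded y Xhat I lam b theta A i].

(* Repeating [screen_step] until nothing changes: a step that changes the set
   removes an element, so [#|A|] repetitions suffice, and further repetitions
   have no effect (see [screen_fixed]). *)
Definition screen (R : realType) (n d m : nat) (y : 'cV[R]_n)
    (Xhat : 'M[R]_(n, d)) (I : 'I_m -> {set 'I_d}) (lam : m.-tuple R)
    (b : 'cV[R]_d) (theta : 'cV[R]_n) (A : {set 'I_m}) : {set 'I_m} :=
  iter #|A| (screen_step y Xhat I lam b theta) A.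

(* Iteration [k] uses the iterates of index [k], so [b 0] and [theta 0] are
   never read. *)
Fixpoint active_sets (R : realType) (n d m : nat) (y : 'cV[R]_n)
    (Xhat : 'M[R]_(n, d)) (I : 'I_m -> {set 'I_d}) (lam : m.-tuple R)
    (b : nat -> 'cV[R]_d) (theta : nat -> 'cV[R]_n) (k : nat) : {set 'I_m} :=
  if k is k'.+1 then
    screen y Xhat I lam (b k) (theta k)
      (active_sets y Xhat I lam b theta k')
  else [set: 'I_m].

Definition relevant_groups (R : realType) (d m : nat) (I : 'I_m -> {set 'I_d})
    (b : 'cV[R]_d) : {set 'I_m} :=
  [set i | row_block b (I i) != 0].

Lemma iter_subset (m : nat) (f : {set 'I_m} -> {set 'I_m}) (A : {set 'I_m}) k :
  (forall B, f B \subset B) -> iter k f A \subset A.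
Proof.
move=> fS; elim: k => [|k IHk] /=; first exact: subxx.
exact: subset_trans (fS _) IHk.
Qed.

Lemma iter_card_fixed (m : nat) (f : {set 'I_m} -> {set 'I_m})
    (A : {set 'I_m}) :
  (forall B, f B \subset B) -> f (iter #|A| f A) = iter #|A| f A.
Proof.
move=> fS.
suff H k : f (iter k f A) = iter k f A \/ (#|iter k f A| + k <= #|A|)%N.
  case: (H #|A|) => // le0.
  have /eqP/cards0_eq-> : #|iter #|A| f A| == 0%N.
    by rewrite -leqn0 -(leq_add2r #|A|).
  by apply/eqP; rewrite -subset0.
elim: k => [|k [IHk|IHk]]; first by right; rewrite addn0.
  by left; rewrite /= !IHk.
case: (eqVneq (f (iter k f A)) (iter k f A)) => [e|ne].
  by left; rewrite /= !e.
right; rewrite addnS; apply: leq_trans IHk.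
by rewrite ltn_add2r /= proper_card // properEneq ne fS.
Qed.

Lemma screen_step_subset (R : realType) (n d m : nat) (y : 'cV[R]_n)
    (Xhat : 'M[R]_(n, d)) (I : 'I_m -> {set 'I_d}) (lam : m.-tuple R)
    (b : 'cV[R]_d) (theta : 'cV[R]_n) (A : {set 'I_m}) :
  screen_step y Xhat I lam b theta A \subset A.
Proof. by apply/subsetP=> i; rewrite inE => /andP[]. Qed.

Lemma screen_fixed (R : realType) (n d m : nat) (y : 'cV[R]_n)
    (Xhat : 'M[R]_(n, d)) (I : 'I_m -> {set 'I_d}) (lam : m.-tuple R)
    (b : 'cV[R]_d) (theta : 'cV[R]_n) (A : {set 'I_m}) :
  screen_step y Xhat I lam b theta (screen y Xhat I lam b theta A)
  = screen y Xhat I lam b theta A.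
Proof. by apply: iter_card_fixed => B; apply: screen_step_subset. Qed.

Lemma active_sets_subset (R : realType) (n d m : nat) (y : 'cV[R]_n)
    (Xhat : 'M[R]_(n, d)) (I : 'I_m -> {set 'I_d}) (lam : m.-tuple R)
    (b : nat -> 'cV[R]_d) (theta : nat -> 'cV[R]_n) (k : nat) :
  active_sets y Xhat I lam b theta k.+1
  \subset active_sets y Xhat I lam b theta k.
Proof. by apply: iter_subset => B; apply: screen_step_subset. Qed.

(* Main.v *)
(** The primal residual [r = Xhat b-star - y] plays the role of the dual optimum.
    Completing the square gives
    [P(b) - D(theta) >= P(b-star) - D(theta)
     = |r - theta|^2 / 2 + <theta, Xhat b-star> + J(b-star)],
    and feasibility of [theta] makes the last two terms nonnegative together,
    so [r] lies within [sqrt (2 G)] of [theta].  Shrinking one relevant group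
    [i] of [b-star] by a factor [1 - e] keeps its rank below the number of
    relevant groups, so the penalty drops by at least
    [e * lambda_|A-star| * |b-star_i|]; minimality then forces
    [|Xhat_i^T r| >= lambda_|A-star|], which excludes the screening test. *)
Require Import Defs.
From mathcomp Require Import boolp classical_sets reals.
From mathcomp Require Import all_boot all_order perm all_algebra.
From mathcomp Require Import ring lra.
Import Order.TTheory GRing.Theory Num.Theory.
Local Open Scope ring_scope.

Set Implicit Arguments.
Unset Strict Implicit.
Unset Printing Implicit Defensive.

(** * Euclidean inner product, Cauchy-Schwarz and the spectral norm *)

Definition dot (R : realType) (n : nat) (u v : 'cV[R]_n) : R :=
  (u^T *m v) 0 0.

Section Euclidean.
Variable R : realType.

Lemma dotE n (u v : 'cV[R]_n) : dot u v = \sum_i u i 0 * v i 0.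
Proof. by rewrite /dot mxE; apply: eq_bigr => i _; rewrite mxE. Qed.

Lemma dotC n (u v : 'cV[R]_n) : dot u v = dot v u.
Proof. by rewrite !dotE; apply: eq_bigr => i _; rewrite mulrC. Qed.

Lemma dotDr n (u v w : 'cV[R]_n) : dot u (v + w) = dot u v + dot u w.
Proof. by rewrite /dot mulmxDr mxE. Qed.

Lemma dotZr n a (u v : 'cV[R]_n) : dot u (a *: v) = a * dot u v.
Proof. by rewrite /dot -scalemxAr mxE. Qed.

Lemma dotDl n (u v w : 'cV[R]_n) : dot (v + w) u = dot v u + dot w u.
Proof. by rewrite !(dotC _ u) dotDr. Qed.

Lemma dotZl n a (u v : 'cV[R]_n) : dot (a *: v) u = a * dot v u.
Proof. by rewrite !(dotC _ u) dotZr. Qed.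

Lemma dotNr n (u v : 'cV[R]_n) : dot u (- v) = - dot u v.
Proof. by rewrite -scaleN1r dotZr mulN1r. Qed.

Lemma dotNl n (u v : 'cV[R]_n) : dot (- v) u = - dot v u.
Proof. by rewrite -scaleN1r dotZl mulN1r. Qed.

Lemma dot_mulmxr n p (A : 'M[R]_(n, p)) u x :
  dot u (A *m x) = dot (A^T *m u) x.
Proof. by rewrite /dot trmx_mul trmxK mulmxA. Qed.

Lemma dot_sumr n (T : finType) (u : 'cV[R]_n) (F : T -> 'cV[R]_n) :
  dot u (\sum_i F i) = \sum_i dot u (F i).
Proof. by rewrite /dot mulmx_sumr summxE. Qed.

Lemma norm2_ge0 n (u : 'cV[R]_n) : 0 <= norm2 u.
Proof. exact: sqrtr_ge0. Qed.

Lemma norm2_sqr n (u : 'cV[R]_n) : norm2 u ^+ 2 = dot u u.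
Proof.
rewrite /norm2 sqr_sqrtr; last by apply: sumr_ge0 => i _; apply: sqr_ge0.
by rewrite dotE; apply: eq_bigr => i _; rewrite expr2.
Qed.

Lemma norm2_eq0 n (u : 'cV[R]_n) : (norm2 u == 0) = (u == 0).
Proof.
apply/idP/eqP => [/eqP u0 | ->]; last first.
  by rewrite /norm2 big1 ?sqrtr0 // => i _; rewrite mxE expr0n.
have := norm2_sqr u; rewrite u0 expr0n /= dotE => /esym s0.
apply/colP => i; rewrite mxE; apply/eqP; rewrite -[_ == 0]orbb -mulf_eq0.
apply/eqP; move: i (erefl true); apply: (psumr_eq0P _ s0) => i _.
by rewrite -expr2 sqr_ge0.
Qed.

Lemma norm2_gt0 n (u : 'cV[R]_n) : (0 < norm2 u) = (u != 0).
Proof. by rewrite lt_def norm2_eq0 norm2_ge0 andbT. Qed.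

Lemma norm2Z n a (u : 'cV[R]_n) : norm2 (a *: u) = `|a| * norm2 u.
Proof.
rewrite /norm2 -sqrtr_sqr -sqrtrM ?sqr_ge0 // mulr_sumr.
by congr Num.sqrt; apply: eq_bigr => i _; rewrite mxE exprMn.
Qed.

Lemma norm2N n (u : 'cV[R]_n) : norm2 (- u) = norm2 u.
Proof. by rewrite -scaleN1r norm2Z normrN1 mul1r. Qed.

Lemma dot_le_norm2 n (u v : 'cV[R]_n) : dot u v <= norm2 u * norm2 v.
Proof.
have [->|u0] := eqVneq u 0.
  by rewrite -(scale0r 0) dotZl mul0r mulr_ge0 // norm2_ge0.
have [->|v0] := eqVneq v 0.
  by rewrite -(scale0r 0) dotZr mul0r mulr_ge0 // norm2_ge0.
have ab0 : 0 < norm2 u * norm2 v by rewrite mulr_gt0 // norm2_gt0.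
(* This square expands to [2 * a * (a - dot u v)] with [a = norm2 u * norm2 v], and [a] is positive
   here. *)
have := sqr_ge0 (norm2 (norm2 v *: u - norm2 u *: v)).
rewrite norm2_sqr !(dotDl, dotDr, dotNl, dotNr, dotZl, dotZr) -!norm2_sqr.
rewrite (dotC v u) => H.
rewrite -(ler_pM2l ab0); nra.
Qed.

Lemma norm2D n (u v : 'cV[R]_n) : norm2 (u + v) <= norm2 u + norm2 v.
Proof.
rewrite -(@ler_pXn2r _ 2) ?nnegrE ?addr_ge0 ?norm2_ge0 //.
rewrite norm2_sqr !(dotDl, dotDr) -!norm2_sqr (dotC v u).
have := dot_le_norm2 u v; nra.
Qed.

(** Cauchy-Schwarz on each row gives the Frobenius bound. It serves to show that the supremum in
    [spectral_norm] is taken over a bounded set. *)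
Lemma norm2_mulmx_bound n p (A : 'M[R]_(n, p)) (x : 'cV[R]_p) :
  norm2 (A *m x) <= Num.sqrt (\sum_i norm2 (row i A)^T ^+ 2) * norm2 x.
Proof.
rewrite -(@ler_pXn2r _ 2) ?nnegrE ?mulr_ge0 ?sqrtr_ge0 ?norm2_ge0 //.
rewrite exprMn [X in _ <= X * _]sqr_sqrtr; last first.
  by apply: sumr_ge0 => i _; apply: sqr_ge0.
rewrite (norm2_sqr (A *m x)) dotE mulr_suml; apply: ler_sum => i _.
have -> : (A *m x) i 0 = dot (row i A)^T x.
  by rewrite dotE mxE; apply: eq_bigr => j _; rewrite !mxE.
have := dot_le_norm2 (row i A)^T x; have := dot_le_norm2 (- (row i A)^T) x.
rewrite dotNl norm2N -expr2 -exprMn => lo hi.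
by rewrite -[X in X <= _]real_normK ?num_real // lerXn2r ?nnegrE ?mulr_ge0
  ?norm2_ge0 // ler_norml; apply/andP; split; [rewrite lerNl|].
Qed.

Lemma norm20 n : norm2 (0 : 'cV[R]_n) = 0.
Proof. by apply/eqP; rewrite norm2_eq0. Qed.

Lemma spectral_norm_has_ubound n p (A : 'M[R]_(n, p)) :
  has_ubound [set norm2 (A *m x) | x in [set x : 'cV[R]_p | norm2 x <= 1]]%classic.
Proof.
exists (Num.sqrt (\sum_i norm2 (row i A)^T ^+ 2)) => _ [z /= z1 <-].
apply: (le_trans (norm2_mulmx_bound A z)).
by rewrite ler_piMr // sqrtr_ge0.
Qed.

Lemma spectral_norm_ge0 n p (A : 'M[R]_(n, p)) : 0 <= spectral_norm A.
Proof.
apply: (ub_le_sup (spectral_norm_has_ubound A)).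
by exists 0; rewrite /= ?mulmx0 norm20.
Qed.

Lemma norm2_mulmx_le n p (A : 'M[R]_(n, p)) (x : 'cV[R]_p) :
  norm2 (A *m x) <= spectral_norm A * norm2 x.
Proof.
have [->|x0] := eqVneq x 0; first by rewrite mulmx0 !norm20 mulr0.
have nx0 : 0 < norm2 x by rewrite norm2_gt0.
rewrite -ler_pdivrMr //; apply: ub_le_sup (spectral_norm_has_ubound A) _ _.
exists ((norm2 x)^-1 *: x).
  by rewrite /= norm2Z gtr0_norm ?invr_gt0 // mulVf // gt_eqF.
by rewrite -scalemxAr norm2Z gtr0_norm ?invr_gt0 // mulrC.
Qed.

(* [|A^T x|^2 = <x, A (A^T x)> <= |x| |A| |A^T x|] *)
Lemma norm2_trmx_mulmx_le n p (A : 'M[R]_(n, p)) (x : 'cV[R]_n) :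
  norm2 (A^T *m x) <= spectral_norm A * norm2 x.
Proof.
have [->|z0] := eqVneq (A^T *m x) 0.
  by rewrite norm20 mulr_ge0 ?norm2_ge0 ?spectral_norm_ge0.
rewrite -(ler_pM2r (_ : 0 < norm2 (A^T *m x))) ?norm2_gt0 //.
rewrite -expr2 norm2_sqr -dot_mulmxr; apply: (le_trans (dot_le_norm2 _ _)).
by rewrite mulrAC mulrC ler_wpM2r ?norm2_ge0 // norm2_mulmx_le.
Qed.

End Euclidean.

(** * Sorted entries, summation by parts and prefix sums *)

Lemma card_ord_lt m k : (k <= m)%N -> #|[set i : 'I_m | (i < k)%N]| = k.
Proof.
move=> km; rewrite -sum1_card (eq_bigl (fun i : 'I_m => (i < k)%N)).
  by rewrite -(big_ord_widen m (fun=> 1%N) km) sum1_card card_ord.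
by move=> i; rewrite inE.
Qed.

Section Sorting.
Variable R : realType.

Lemma size_sorted_entries m (v : 'cV[R]_m) : size (sorted_entries v) = m.
Proof. by rewrite size_sort size_map size_enum_ord. Qed.

Lemma sorted_nth_le (s : seq R) i j :
  sorted >=%R s -> (i <= j)%N -> (j < size s)%N -> s`_j <= s`_i.
Proof.
move=> ss ij js.
have tr : transitive (>=%R : rel R) by move=> a b c ba ac; apply: le_trans ac ba.
have := sorted_leq_nth tr (fun x => lexx x) 0 ss; apply=> //; rewrite inE //.
exact: leq_ltn_trans js.
Qed.

Lemma sorted_entries_sorted m (v : 'cV[R]_m) : sorted >=%R (sorted_entries v).
Proof. by apply: sort_sorted => x y; rewrite le_total. Qed.

(** Turns sorting into a reindexing: [s k] is the index of an entry placed at sorted position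
    [k]. *)
Lemma sorted_entries_perm m (v : 'cV[R]_m) :
  exists s : 'S_m, forall k : 'I_m, (sorted_entries v)`_k = v (s k) 0.
Proof.
pose t := [tuple v i 0 | i < m].
have : perm_eq (sorted_entries v) t.
  by rewrite /sorted_entries perm_sort.
move/tuple_permP => [s es]; exists s => k.
rewrite es; have := nth_mktuple (fun i => tnth t (s i)) 0 k.
by move=> /= ->; rewrite tnth_mktuple.
Qed.

(** Summation by parts: with [S k] the sum of [y i - x i] over [i < k], the right side minus the
    left is [a (n-1) S n] plus the sum of [(a k - a (k+1)) S (k+1)] over [k < n-1], and every term
    is nonnegative. *)
Lemma ler_sum_abel (a x y : nat -> R) n :
  (forall i, (i < n)%N -> 0 <= a i) ->
  (forall i j, (i <= j < n)%N -> a j <= a i) ->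
  (forall k, (k <= n)%N -> \sum_(i < k) x i <= \sum_(i < k) y i) ->
  \sum_(i < n) a i * x i <= \sum_(i < n) a i * y i.
Proof.
move=> a0 ai xy; rewrite -subr_ge0 -sumrB.
case: n a0 ai xy => [|n] a0 ai xy; first by rewrite big_ord0.
(* The left side is the boundary term. In the induction [a k] may be lowered to [a k.+1] because it
   multiplies a nonnegative difference of partial sums. *)
suff H k : (k <= n)%N -> a k * (\sum_(i < k.+1) y i - \sum_(i < k.+1) x i) <=
    \sum_(i < k.+1) (a i * y i - a i * x i).
  by apply: le_trans _ (H n (leqnn n)); rewrite mulr_ge0 ?a0 // subr_ge0 xy.
elim: k => [_|k IHk kn]; first by rewrite !big_ord1 mulrBr.
rewrite [X in _ <= X]big_ord_recr /=.
apply: le_trans _ (lerD (IHk (ltnW kn)) (lexx _)).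
have ak : a k.+1 <= a k by apply: ai; rewrite leqnSn ltnS.
have := xy k.+1 (leqW kn); rewrite -subr_ge0 => xyk.
have recr (z : nat -> R) : \sum_(i < k.+2) z i = \sum_(i < k.+1) z i + z k.+1 :> R.
  by rewrite big_ord_recr.
rewrite !recr.
have := ler_wpM2r xyk ak; lra.
Qed.

(* Pointwise comparison of the indicator sums of [u k - u #|A|.-1]: it is
   nonnegative exactly where [k < #|A|]. *)
Lemma ler_sum_set_prefix m (u : nat -> R) (A : {set 'I_m}) :
  (forall i j, (i <= j < m)%N -> u j <= u i) ->
  \sum_(i in A) u i <= \sum_(i < #|A|) u i.
Proof.
move=> ud; have Am : (#|A| <= m)%N by rewrite -[leqRHS]card_ord max_card.
rewrite (big_ord_widen m u Am).
have [A0|A0] := posnP #|A|.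
  by rewrite (cards0_eq A0) cards0 !big_pred0 // => i; rewrite ?inE ?ltn0.
set c := u #|A|.-1.
have cA : \sum_(i in A) c = \sum_(i < m | (i < #|A|)%N) c.
  rewrite -(big_ord_widen m (fun=> c) Am) sumr_const.
  by rewrite sumr_const card_ord.
rewrite -(lerD2r (- \sum_(i in A) c)) {2}cA -!sumrB.
rewrite big_mkcond [leRHS]big_mkcond /=; apply: ler_sum => i _.
case: (i \in A); case: ltnP => // iA; rewrite ?subr_le0 ?subr_ge0.
- apply: ud; rewrite ltn_ord andbT (leq_trans _ iA) //; exact: leq_pred.
- by apply: ud; rewrite -ltnS prednK // iA Am.
Qed.

Lemma ler_sum_perm_sorted m (v : 'cV[R]_m) (s : 'S_m) k : (k <= m)%N ->
  \sum_(i < m | (i < k)%N) v (s i) 0 <= \sum_(i < k) (sorted_entries v)`_i.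
Proof.
move=> km; have [p pE] := sorted_entries_perm v.
(* [p] sends sorted positions to indices, so [A] collects the sorted positions of the summed
   entries. It has [k] elements, and the first [k] positions carry the largest sum. *)
pose A := [set (p^-1)%g (s i) | i : 'I_m & (i < k)%N].
have inj : injective (fun i : 'I_m => (p^-1)%g (s i)).
  by move=> i j /perm_inj /perm_inj.
have cA : #|A| = k by rewrite card_imset ?card_ord_lt.
have -> : \sum_(i < m | (i < k)%N) v (s i) 0 =
    \sum_(i in A) (sorted_entries v)`_i.
  rewrite big_imset /=; last by move=> i j _ _; apply: inj.
  by apply: eq_big => i; rewrite ?inE // pE permKV.
rewrite -[in X in _ <= X]cA.
apply: (@ler_sum_set_prefix m (fun i => (sorted_entries v)`_i)).
move=> i j /andP[ij jm].
by apply: sorted_nth_le; rewrite ?sorted_entries_sorted ?size_sorted_entries.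
Qed.

End Sorting.

(** * The sorted penalty: rearrangement inequality and effect of shrinking one entry *)

Section SlopeNorm.
Variables (R : realType) (m : nat) (lam : m.-tuple R).
Hypothesis lam_noninc : sorted >=%R lam.
Hypothesis lam_ge0 : forall i, 0 <= tnth lam i.

Lemma lam_nth_ge0 i : 0 <= lam`_i.
Proof.
have [im|im] := ltnP i m; last by rewrite nth_default // size_tuple.
by have := lam_ge0 (Ordinal im); rewrite (tnth_nth 0).
Qed.

(** Holds for all naturals: beyond the tuple the default value is 0, which lies below every
    nonnegative weight. *)
Lemma lam_nth_le i j : (i <= j)%N -> lam`_j <= lam`_i.
Proof.
move=> ij; have [jm|jm] := ltnP j m.
  by apply: sorted_nth_le; rewrite ?size_tuple.
by rewrite [X in X <= _]nth_default ?size_tuple // lam_nth_ge0.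
Qed.

Variable v : 'cV[R]_m.
Hypothesis v_ge0 : forall i, 0 <= v i 0.

Lemma slope_norm_nneg :
  slope_norm lam v = \sum_(i < m) lam`_i * (sorted_entries v)`_i.
Proof.
rewrite /slope_norm; suff -> : map_mx Num.norm v = v by [].
by apply/colP => i; rewrite mxE ger0_norm.
Qed.

(** Rearrangement inequality, by summation by parts with weights [lam]: any [k] entries sum to at
    most the [k] largest. *)
Lemma slope_norm_ge_perm (s : 'S_m) :
  \sum_(k < m) lam`_k * v (s k) 0 <= slope_norm lam v.
Proof.
rewrite slope_norm_nneg.
(* [ler_sum_abel] takes sequences over the naturals, hence the extension by 0. *)
pose x k := if insub k is Some i then v (s i) 0 else 0.
have xE (i : 'I_m) : x i = v (s i) 0 by rewrite /x valK.
rewrite [leLHS](eq_bigr (fun k : 'I_m => lam`_k * x k)); last first.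
  by move=> k _; rewrite xE.
apply: (@ler_sum_abel _ (fun k => lam`_k) x (fun k => (sorted_entries v)`_k)).
- by move=> i _; apply: lam_nth_ge0.
- by move=> i j /andP[ij _]; apply: lam_nth_le.
move=> k km; apply: le_trans (ler_sum_perm_sorted v s km).
by rewrite (big_ord_widen m x km); under eq_bigr do rewrite xE.
Qed.

End SlopeNorm.

(** The permutation sorting the smaller vector [v'] computes [slope_norm lam v'] exactly and bounds
    [slope_norm lam v] from below. The two sums differ only at the position [k] of entry [i], and
    [k] is below the number of nonzero entries of [v']. *)
Lemma slope_norm_shrink (R : realType) m (lam : m.-tuple R) (v v' : 'cV[R]_m)
    (i : 'I_m) :
  sorted >=%R lam -> (forall i, 0 <= tnth lam i) ->
  (forall j, 0 <= v' j 0) -> (forall j, j != i -> v' j 0 = v j 0) ->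
  0 < v' i 0 -> v' i 0 <= v i 0 ->
  slope_norm lam v' +
    lam`_(#|[set j | v' j 0 != 0]|.-1) * (v i 0 - v' i 0) <= slope_norm lam v.
Proof.
move=> lamn lam0 v'0 v'v v'i vi.
have v0 j : 0 <= v j 0.
  by have [->|ji] := eqVneq j i; [exact: le_trans vi | rewrite -v'v].
have [s sE] := sorted_entries_perm v'.
apply: le_trans (slope_norm_ge_perm lamn lam0 v0 s).
rewrite slope_norm_nneg // (eq_bigr (fun k : 'I_m => lam`_k * v' (s k) 0));
  last by move=> k _; rewrite sE.
rewrite -lerBrDl -sumrB; pose k := (s^-1)%g i.
have sk : s k = i by rewrite permKV.
rewrite (bigD1 k) //= big1 ?addr0 => [|j jk]; last first.
  by rewrite v'v ?subrr // -sk (inj_eq perm_inj).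
rewrite sk -mulrBr ler_wpM2r ?subr_ge0 //; apply: lam_nth_le => //.
suff : (k < #|[set j | (v' j 0 != 0)%R]|)%N by case: #|_|.
(* Sorted positions [0] to [k] hold [k.+1] entries of [v'], each at least [v' i 0] and hence
   nonzero. *)
have -> : k.+1 = #|[set s j | j : 'I_m & (j < k.+1)%N]|.
  by rewrite card_imset ?card_ord_lt //; exact: perm_inj.
apply: subset_leq_card; apply/subsetP => _ /imsetP[j jk ->]; rewrite !inE in jk *.
rewrite gt_eqF // (lt_le_trans v'i) // -sk -!sE.
by apply: sorted_nth_le; rewrite ?sorted_entries_sorted ?size_sorted_entries.
Qed.

(** * Block decomposition along the groups and weak duality *)

Section Groups.
Variables (R : realType) (n d m : nat) (I : 'I_m -> {set 'I_d}).
Hypothesis I_inj : injective I.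
Hypothesis I_part : partition (I @: [set: 'I_m]) [set: 'I_d].

Definition group_norms (b : 'cV[R]_d) : 'cV[R]_m :=
  \col_i norm2 (row_block b (I i)).

Lemma group_norms_ge0 b i : 0 <= group_norms b i 0.
Proof. by rewrite mxE norm2_ge0. Qed.

Lemma relevant_groupsE b :
  relevant_groups I b = [set i | group_norms b i 0 != 0].
Proof. by apply/setP => i; rewrite !inE mxE norm2_eq0. Qed.

(** The sum over columns splits along the partition; injectivity of [I] turns the sum over blocks as
    sets into a sum over group indices. *)
Lemma mulmx_row_blocks (A : 'M[R]_(n, d)) (b : 'cV[R]_d) :
  A *m b = \sum_i col_block A (I i) *m row_block b (I i).
Proof.
apply/colP => k; rewrite summxE mxE.
rewrite -(eq_bigl _ _ (in_setT (T := 'I_d))) (set_partition_big _ I_part) /=.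
rewrite big_imset /=; last by move=> i j _ _; apply: I_inj.
apply: eq_big => i; rewrite ?inE // => _.
by rewrite mxE big_enum_val; apply: eq_bigr => j _; rewrite !mxE.
Qed.

(** The perturbation direction: subtracting [e] times it rescales group [i] by [1 - e] and leaves
    the other groups alone. *)
Definition group_part (b : 'cV[R]_d) (i : 'I_m) : 'cV[R]_d :=
  \col_j (if j \in I i then b j 0 else 0).

Lemma row_block_group_part b i j :
  row_block (group_part b i) (I j) = if j == i then row_block b (I j) else 0.
Proof.
have [->|ji] := eqVneq j i; apply/colP => k; rewrite !mxE.
  by rewrite enum_valP.
case: ifP => // ki; have /and3P[_ /trivIsetP tI _] := I_part.
have /setP/(_ (enum_val k)) := disjoint_setI0 (tI _ _ (imset_f I (in_setT j))
  (imset_f I (in_setT i)) (contra_neq (@I_inj j i) ji)).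
by rewrite !inE ki enum_valP.
Qed.

Lemma mulmx_group_part (A : 'M[R]_(n, d)) b i :
  A *m group_part b i = col_block A (I i) *m row_block b (I i).
Proof.
rewrite mulmx_row_blocks (bigD1 i) //= big1 => [|j ji].
  by rewrite addr0 row_block_group_part eqxx.
by rewrite row_block_group_part (negPf ji) mulmx0.
Qed.

Lemma row_blockD (b c : 'cV[R]_d) S :
  row_block (b + c) S = row_block b S + row_block c S.
Proof. by apply/colP => k; rewrite !mxE. Qed.

Lemma row_blockZ a (b : 'cV[R]_d) S : row_block (a *: b) S = a *: row_block b S.
Proof. by apply/colP => k; rewrite !mxE. Qed.

Variables (y : 'cV[R]_n) (Xhat : 'M[R]_(n, d)) (lam : m.-tuple R).
Hypothesis lam_noninc : sorted >=%R lam.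
Hypothesis lam_ge0 : forall i, 0 <= tnth lam i.

(** Blockwise Cauchy-Schwarz bounds the negated pairing by the products of group correlations and
    group norms. Feasibility then lets [lam] replace the correlations in the order that sorts the
    norms. *)
Lemma dual_feasible_pairing b theta : dual_feasible Xhat I lam theta ->
  0 <= dot theta (Xhat *m b) + slope_norm lam (group_norms b).
Proof.
move=> feas; rewrite addrC -[dot _ _]opprK subr_ge0 -dotNl mulmx_row_blocks dot_sumr.
set t := group_corr Xhat I theta; set v := group_norms b.
have t0 i : 0 <= t i 0 by rewrite mxE norm2_ge0.
have v0 := group_norms_ge0 b.
apply: (@le_trans _ _ (\sum_i t i 0 * v i 0)).
  apply: ler_sum => i _; rewrite dot_mulmxr.
  by apply: le_trans (dot_le_norm2 _ _) _; rewrite mulmxN norm2N !mxE.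
have [s sE] := sorted_entries_perm v.
rewrite slope_norm_nneg // (reindex_inj (@perm_inj _ s)) /=.
pose x k := if insub k is Some i then t (s i) 0 else 0.
have xE (i : 'I_m) : x i = t (s i) 0 by rewrite /x valK.
rewrite (eq_bigr (fun k : 'I_m => (sorted_entries v)`_k * x k)); last first.
  by move=> k _; rewrite xE sE mulrC.
rewrite [leRHS](eq_bigr (fun k : 'I_m => (sorted_entries v)`_k * lam`_k));
  last by move=> k _; rewrite mulrC.
(* Here the sorted group norms are the weights, and [lam] is one of the compared sequences. *)
apply: (@ler_sum_abel _ (fun k => (sorted_entries v)`_k) x (fun k => lam`_k)).
- by move=> i im; rewrite (sE (Ordinal im)).
- move=> i j /andP[ij jm]; apply: sorted_nth_le => //.
    exact: sorted_entries_sorted.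
  by rewrite size_sorted_entries.
(* Feasibility at 0-based index [k] bounds the first [k.+1] entries, so the empty prefix is treated
   apart. *)
case=> [|k] km; first by rewrite !big_ord0.
have := feas (Ordinal km) => /=; rewrite -/t => fk.
rewrite (big_ord_widen m x km) (big_ord_widen m (fun k => lam`_k) km).
apply: (le_trans _ fk); rewrite [leLHS](eq_bigr (fun i : 'I_m => t (s i) 0));
  last by move=> i _; rewrite xE.
apply: le_trans (ler_sum_perm_sorted t s km) _.
by rewrite (big_ord_widen m (fun k => (sorted_entries t)`_k) km).
Qed.

(** * Optimality of [bstar] and safety of the screening test *)

Variable bstar : 'cV[R]_d.
Hypothesis bstar_min :
  forall b, primal y Xhat I lam bstar <= primal y Xhat I lam b.

Let r := Xhat *m bstar - y.

Lemma residual_dist_le_gap b theta : dual_feasible Xhat I lam theta ->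
  norm2 (r - theta) <= Num.sqrt (2 * gap y Xhat I lam b theta).
Proof.
move=> feas; rewrite -[leLHS]ger0_norm ?norm2_ge0 // -sqrtr_sqr ler_wsqrtr //.
(* Minimality replaces [b] by [bstar], after which the square can be completed. *)
rewrite /gap; apply: le_trans
  (_ : 2 * (primal y Xhat I lam bstar - dual y theta) <= _); last first.
  by rewrite ler_pM2l // lerB.
have -> : dual y theta = - (2^-1 * dot theta theta + dot theta y).
  by rewrite /dual !dotE mulr_sumr -big_split.
have := dual_feasible_pairing bstar feas.
rewrite /primal -/(group_norms bstar) -norm2N opprB -/r norm2_sqr => H.
rewrite norm2_sqr.
(* Eliminating [Xhat *m bstar] leaves an inequality linear in inner products of the residual,
   [theta] and [y]. *)
have rE : Xhat *m bstar = r + y by rewrite subrK.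
move: H; rewrite rE; move: r => q.
rewrite !(dotDl, dotDr, dotNl, dotNr) (dotC q theta); lra.
Qed.

(** The quadratic loss is expanded exactly, while the penalty is bounded through
    [slope_norm_shrink]. *)
Lemma primal_group_scale_le i e :
  i \in relevant_groups I bstar -> 0 < e -> e < 1 ->
  primal y Xhat I lam (bstar - e *: group_part bstar i) <=
  primal y Xhat I lam bstar
  - e * dot r (col_block Xhat (I i) *m row_block bstar (I i))
  + 2^-1 * e ^+ 2 * norm2 (col_block Xhat (I i) *m row_block bstar (I i)) ^+ 2
  - lam`_(#|relevant_groups I bstar|.-1) * (e * group_norms bstar i 0).
Proof.
move=> irel e0 e1; set b' := bstar - _; set z := _ *m row_block bstar _.
have b'E j : group_norms b' j 0 =
    (if j == i then 1 - e else 1) * group_norms bstar j 0.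
  rewrite mxE row_blockD -scaleN1r !row_blockZ row_block_group_part.
  have [->|ji] := eqVneq j i; last by rewrite !scaler0 addr0 mul1r mxE.
  rewrite scaleN1r -[X in X - _]scale1r -scalerBl norm2Z gtr0_norm ?subr_gt0 //.
  by rewrite [in RHS]mxE.
have bi0 : 0 < group_norms bstar i 0.
  by rewrite lt_def group_norms_ge0 andbT; rewrite relevant_groupsE inE in irel.
have := @slope_norm_shrink _ _ lam (group_norms bstar) (group_norms b') i
  lam_noninc lam_ge0 (group_norms_ge0 b').
rewrite !b'E eqxx.
(* Since [1 - e] is nonzero, the set of nonzero groups is unchanged, so the weight index is that of
   [bstar]. *)
have -> : [set j | group_norms b' j 0 != 0] = relevant_groups I bstar.
  rewrite relevant_groupsE; apply/setP => j; rewrite !inE b'E mulf_eq0.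
  by case: ifP => _; rewrite ?oner_eq0 // subr_eq0 gt_eqF.
have off j : j != i -> group_norms b' j 0 = group_norms bstar j 0.
  by move=> ji; rewrite b'E (negPf ji) mul1r.
have ei0 : 0 < (1 - e) * group_norms bstar i 0 by rewrite mulr_gt0 // subr_gt0.
have ei1 : (1 - e) * group_norms bstar i 0 <= group_norms bstar i 0.
  by rewrite ler_piMl ?(ltW bi0) // gerBl ltW.
move=> /(_ off ei0 ei1).
set L := lam`_ _; set g := group_norms bstar i 0 => sl.
rewrite /primal -/(group_norms bstar) -/(group_norms b').
rewrite -[norm2 (y - _ *m bstar)]norm2N -[norm2 (y - _ *m b')]norm2N !opprB -/r.
have -> : Xhat *m b' - y = r - e *: z.
  by rewrite mulmxDr mulmxN -scalemxAr mulmx_group_part addrAC.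
rewrite !norm2_sqr; move: r z => q z.
rewrite !(dotDl, dotDr, dotNl, dotNr, dotZl, dotZr) (dotC z q).
nra.
Qed.

(** First-order optimality in the shrinking direction, obtained from one small step instead of a
    subgradient. *)
Lemma relevant_group_corr_ge i : i \in relevant_groups I bstar ->
  lam`_(#|relevant_groups I bstar|.-1) <= norm2 ((col_block Xhat (I i))^T *m r).
Proof.
move=> irel; have bi0 : 0 < group_norms bstar i 0.
  by rewrite lt_def group_norms_ge0 andbT; rewrite relevant_groupsE inE in irel.
have := fun e => primal_group_scale_le irel (e := e).
set L := lam`_ _; set z := _ *m row_block bstar _ => scale.
rewrite -(ler_pM2r bi0); set g := group_norms bstar i 0.
have cs : - dot r z <= norm2 ((col_block Xhat (I i))^T *m r) * g.
  rewrite /z dot_mulmxr -dotNl; apply: le_trans (dot_le_norm2 _ _) _.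
  by rewrite norm2N /g mxE.
apply: le_trans cs; rewrite leNgt; apply/negP => lt.
set N := norm2 z ^+ 2; have N0 : 0 <= N by apply: sqr_ge0.
pose D := L * g + dot r z; have D0 : 0 < D by rewrite /D; lra.
(* This step size gives [e < 1] and [e * N < D], so the gain [e * D] exceeds the quadratic loss
   [e ^+ 2 * N / 2], against minimality. *)
pose e := D / (D + N + 1).
have DN : 0 < D + N + 1 by lra.
have e0 : 0 < e by apply: divr_gt0.
have e1 : e < 1 by rewrite /e ltr_pdivrMr //; lra.
have eD : e * (D + N + 1) = D by rewrite /e divfK // gt_eqF.
have := le_trans (bstar_min _) (scale e e0 e1).
rewrite -/N -/g => H.
have H2 : e * (D - 2^-1 * e * N) <= 0 by rewrite /D; nra.
move: H2; rewrite pmulr_rle0 //; nra.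
Qed.

(** As [A] contains the relevant groups, its threshold is at most theirs. The correlation with [r]
    is at least that, and the triangle inequality bounds it by the tested quantity. *)
Lemma relevant_not_discarded b theta (A : {set 'I_m}) i :
  dual_feasible Xhat I lam theta -> relevant_groups I bstar \subset A ->
  i \in relevant_groups I bstar -> ~~ discarded y Xhat I lam b theta A i.
Proof.
move=> feas relA irel; rewrite /discarded -leNgt.
apply: le_trans (_ : lam`_(#|relevant_groups I bstar|.-1) <= _).
  by apply: lam_nth_le => //; rewrite -!subn1 leq_sub2r // subset_leq_card.
apply: le_trans (relevant_group_corr_ge irel) _.
have -> : r = theta + (r - theta) by rewrite addrC subrK.
rewrite mulmxDr; apply: le_trans (norm2D _ _) _; rewrite lerD2l.
apply: le_trans (norm2_trmx_mulmx_le _ _) _.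
by rewrite ler_wpM2l ?spectral_norm_ge0 // residual_dist_le_gap.
Qed.

Lemma relevant_sub_screen b theta (A : {set 'I_m}) :
  dual_feasible Xhat I lam theta -> relevant_groups I bstar \subset A ->
  relevant_groups I bstar \subset screen y Xhat I lam b theta A.
Proof.
(* Only the repetition count is generalized; the starting set [A] stays fixed. *)
move=> feas relA; rewrite /screen; elim: #|A| => //= k IHk.
apply/subsetP => i irel; rewrite inE (subsetP IHk) //=.
exact: relevant_not_discarded.
Qed.

End Groups.

Theorem mainTheorem1 (R : realType) (n d m : nat)
  (X : 'M[R]_(n, d)) (y : 'cV[R]_n)
  (I : 'I_m -> {set 'I_d})
  (I_inj : injective I)
  (I_part : partition (I @: [set: 'I_m]) [set: 'I_d])
  (w : 'I_m -> R) (w_gt0 : forall i, 0 < w i)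
  (lam : m.-tuple R)
  (lam_noninc : sorted >=%R lam)
  (lam_ge0 : forall i, 0 <= tnth lam i)
  (U : forall i : 'I_m, 'M[R]_(n, #|I i|))
  (Rf : forall i : 'I_m, 'M[R]_#|I i|)
  (U_orth : forall i, (U i)^T *m U i = 1%:M)
  (Rf_full : forall i, row_free (Rf i))
  (X_fact : forall i, col_block X (I i) = U i *m Rf i)
  (Xhat : 'M[R]_(n, d))
  (Xhat_block : forall i, col_block Xhat (I i) = (w i)^-1 *: U i)
  (bstar : 'cV[R]_d)
  (bstar_min : forall b : 'cV[R]_d,
     primal y Xhat I lam bstar <= primal y Xhat I lam b)
  (b : nat -> 'cV[R]_d) (theta : nat -> 'cV[R]_n)
  (theta_feas : forall k, (1 <= k)%N -> dual_feasible Xhat I lam (theta k)) :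
  (forall k, relevant_groups I bstar
               \subset active_sets y Xhat I lam b theta k)
  /\
  (forall k (i : 'I_m),
     i \in active_sets y Xhat I lam b theta k
             :\: active_sets y Xhat I lam b theta k.+1 ->
     row_block bstar (I i) = 0).
Proof.
have rel k : relevant_groups I bstar
    \subset active_sets y Xhat I lam b theta k.
  (* Iteration [k.+1] reads [theta k.+1], whose index is at least 1 as [theta_feas] requires. *)
  elim: k => [|k IHk] /=; first exact: subsetT.
  by apply: relevant_sub_screen => //; apply: theta_feas.
split=> // k i; rewrite inE => /andP[/negP ni _].
apply: contrapT => /eqP bi; apply: ni; apply: (subsetP (rel k.+1)).
by rewrite inE.
Qed.
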